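(* Let $s\ge 1$ be an integer, $C>1$ and $\delta<C-1$. For each sufficiently large integer $N$ let $f=\lceil 4C(s^2+1)\log N\rceil$ and let $\Omega$ be chosen uniformly at random among the subsets of $\mathbb{Z}/N\mathbb{Z}$ of cardinality $f$. Then $$P\big(\text{every } x:\mathbb{Z}/N\mathbb{Z}\to\mathbb{C} \text{ with } \|x\|_0\le s \text{ has property (i)}\big)=1-O(N^{-\delta})\qquad(N\to\infty),$$ i.e. there is a constant $A$ (depending only on $s,C,\delta$) such that this probability is at least $1-AN^{-\delta}$ for all sufficiently large $N$. Here $x$ has property (i) (relative to $\Omega$) if for every $y:\mathbb{Z}/N\mathbb{Z}\to\mathbb{C}$ with $y\neq x$ and $\hat y|_\Omega=\hat x|_\Omega$ one has $\|y\|_1>\|x\|_1$.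
   Context: For $x:\mathbb{Z}/N\mathbb{Z}\to\mathbb{C}$: $\|x\|_0$ is the cardinality of the support of $x$, $\|x\|_1=\sum_t|x(t)|$, and $\hat x(\omega)=\frac1{\sqrt N}\sum_{t\in\mathbb{Z}/N\mathbb{Z}}x(t)\exp(-2\pi i t\omega/N)$ for $\omega\in\mathbb{Z}/N\mathbb{Z}$. Property (i) says that $\hat x$ is the unique extension of $\hat x|_\Omega$ of minimal norm in the Wiener algebra, where $\|\hat x\|_A=\|x\|_1$. $\log$ is the natural logarithm; $N$ is large enough that $f<N$. *)

(* Defs.v *)
From mathcomp Require Import all_boot all_order all_algebra.
From mathcomp Require Import complex.
From mathcomp Require Import all_classical all_reals all_analysis.

Set Implicit Arguments.
Unset Strict Implicit.
Unset Printing Implicit Defensive.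

Import Order.TTheory GRing.Theory Num.Theory.
Import numFieldNormedType.Exports.

Local Open Scope ring_scope.

(* Signals on Z/NZ are elements of {ffun 'Z_N -> R[i]}. For N <= 1 the type
   'Z_N is Z/2Z, so these definitions have their intended meaning for 1 < N. *)

(* exp (i * theta) for real theta *)
Definition expi (R : realType) (theta : R) : R[i] :=
  Complex (cos theta) (sin theta).

(* t * w is the product of the representatives in {0, .., N-1}; the exponential
   only depends on its class modulo N. *)
Definition dft (R : realType) (N : nat) (x : {ffun 'Z_N -> R[i]}) :
    {ffun 'Z_N -> R[i]} :=
  [ffun w : 'Z_N =>
    real_complex R (Num.sqrt N%:R)^-1 *
    \sum_(t : 'Z_N) x t * expi (- (2 * pi * (t * w)%N%:R / N%:R))].

Definition l0norm (R : realType) (N : nat) (x : {ffun 'Z_N -> R[i]}) : nat :=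
  #|[set t | x t != 0]|.

(* normc is the R-valued modulus, whereas `|_| on R[i] takes values in R[i]. *)
Definition l1norm (R : realType) (N : nat) (x : {ffun 'Z_N -> R[i]}) : R :=
  \sum_(t : 'Z_N) ComplexField.Normc.normc (x t).

(* The Wiener norm of a function on the frequency side is the l1 norm of its
   inverse Fourier transform, so this says that dft x is the unique extension of
   its restriction to Omega of minimal Wiener norm. *)
Definition unique_min_extension (R : realType) (N : nat) (Omega : {set 'Z_N})
    (x : {ffun 'Z_N -> R[i]}) : Prop :=
  forall y : {ffun 'Z_N -> R[i]},
    y <> x -> (forall w, w \in Omega -> dft y w = dft x w) ->
    l1norm x < l1norm y.

(* Probability of the event E for the uniform distribution on the finite set A,
   assumed nonempty *)
Definition unif_prob (R : realType) (T : finType) (A : {set T})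
    (E : T -> Prop) : R :=
  #|[set a in A | `[< E a >]]|%:R / #|A|%:R.

(* The argument of the ceiling is nonnegative for 0 <= C and 1 <= N, so the
   absolute value only converts from int to nat. *)
Definition sample_size (R : realType) (s : nat) (C : R) (N : nat) : nat :=
  `|Num.ceil (4 * C * (s ^ 2 + 1)%N%:R * ln N%:R)|%N.

(* Main.v *)
Require Import Defs.
From mathcomp Require Import all_boot all_order all_algebra.
From mathcomp Require Import complex.
From mathcomp Require Import all_classical all_reals all_analysis.
From mathcomp Require Import ring lra zify.

Set Implicit Arguments.
Unset Strict Implicit.
Unset Printing Implicit Defensive.

Import Order.TTheory GRing.Theory Num.Theory.
Import numFieldNormedType.Exports.

Local Open Scope classical_set_scope.
Local Open Scope ring_scope.

(** With zeta = exp (2 i pi / N), put S(t) = \sum_(k in Omega) zeta^(t k), so that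
    S(0) = f. If z has a Fourier transform vanishing on Omega, then z(t) f is minus
    the sum of the z(r) S(t - r) over r <> t; hence |S| small off 0 prevents z from
    having half of its l1 mass on s points, and this is property (i).

    For a fixed t, Re (w S(t)) is a sum of f random draws; a Chernoff bound with
    E c^2 = 1/2 gives P (|S(t)| > f tau) = O(N^-C) for tau = 1/(2s), and a union
    bound over t costs a factor N. The variance is 1 when 2 t = 0, and the third
    moment is not 0 when 3 t = 0, so these at most three t get larger thresholds
    tau; the sum of the thresholds over s points and over s - 1 points together
    still stays below 1. *)

(** * A quartic upper bound for the exponential *)

(* The derivative of P(x) exp (-x), with P the right-hand side, has the sign of
   x^3 (1 - x); 1/18 is the least coefficient of x^4 for which this works. *)
Lemma expR_le_quartic (R : realType) (x : R) : x <= 1 ->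
  expR x <= 1 + x + x ^+ 2 / 2 + x ^+ 3 / 6 + x ^+ 4 / 18.
Proof.
move=> x1.
pose p : {poly R} := Poly [:: 1; 1; 2^-1; 6^-1; 18^-1].
pose h : R -> R := horner p * (expR \o -%R).
have pE (y : R) : p.[y] = 1 + y + y ^+ 2 / 2 + y ^+ 3 / 6 + y ^+ 4 / 18.
  by rewrite horner_Poly /=; field.
have p'E (y : R) : p^`().[y] = 1 + y + y ^+ 2 / 2 + 2 * y ^+ 3 / 9.
  by rewrite /p /= !cons_poly_def !derivCE !hornerE /=; field.
have dh : forall y : R, is_derive y (1:R) h (y ^+ 3 * (1 - y) / 18 * expR (- y)).
  move=> y; apply: is_derive_eq => /=.
  by rewrite pE p'E /GRing.scale /=; field.
have dh1 (y : R) : derivable h y 1 by apply: ex_derive.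
have h'E (y : R) : derive1 h y = y ^+ 3 * (1 - y) / 18 * expR (- y).
  by rewrite derive1E; apply: derive_val.
have ch (a b : R) : {within `[a, b], continuous h}.
  by apply: derivable_within_continuous => y _; exact: dh1.
have hE (y : R) : h y = (1 + y + y ^+ 2 / 2 + y ^+ 3 / 6 + y ^+ 4 / 18) * expR (- y).
  by rewrite -pE.
have h0 : h 0 = 1 by rewrite hE oppr0 expR0; field.
have hx : 1 <= h x.
  rewrite -h0; have [x0|x0] := leP 0 x.
    apply: (@ger0_derive1_le_cc _ h 0 x).
    - by move=> y _; exact: dh1.
    - move=> y; rewrite in_itv /= h'E => /andP[y0 yx]; apply: mulr_ge0 (expR_ge0 _).
      have y1 : 0 <= 1 - y by lra.
      by rewrite divr_ge0// mulr_ge0// exprn_ge0// ltW.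
    - exact: ch.
    - by rewrite in_itv /= lexx.
    - by rewrite in_itv /= lexx x0.
    - exact: x0.
  apply: (@ler0_derive1_le_cc _ h x 0).
  - by move=> y _; exact: dh1.
  - move=> y; rewrite in_itv /= h'E => /andP[yx y0]; rewrite pmulr_lle0 ?expR_gt0//.
    rewrite ler_pdivrMr// mul0r exprS -mulrA nmulr_rle0//.
    have y1 : 0 <= 1 - y by lra.
    by rewrite mulr_ge0// sqr_ge0.
  - exact: ch.
  - by rewrite in_itv /= lexx ltW.
  - by rewrite in_itv /= lexx ltW.
  - exact: ltW.
by move: hx; rewrite hE expRN ler_pdivlMr ?expR_gt0// mul1r.
Qed.

(** * Sampling without replacement compared with independent draws *)

(** Expanding the power gives a sum over all maps from ['I_f] to [T]. Only the injective ones are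
    kept, and each set of size [f] is the image of exactly f! of them. *)
Lemma sum_prod_draws (R : realType) (T : finType) (a : T -> R) (f : nat) :
  (forall k, 0 <= a k) ->
  f`!%:R * (\sum_(A : {set T} | #|A| == f) \prod_(k in A) a k)
  <= (\sum_k a k) ^+ f.
Proof.
move=> a0.
have -> : (\sum_k a k) ^+ f = \sum_(g : {ffun 'I_f -> T}) \prod_i a (g i).
  by rewrite -(bigA_distr_bigA (fun _ => a)) prodr_const card_ord.
pose im (g : {ffun 'I_f -> T}) := (g @: 'I_f)%SET.
have inj_im (g : {ffun 'I_f -> T}) : injectiveb g -> #|im g| == f.
  by move=> /injectiveP ig; rewrite card_imset// card_ord.
apply: le_trans (_ : \sum_(g : {ffun 'I_f -> T} | injectiveb g)
   \prod_i a (g i) <= _); last first.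
  rewrite [leRHS](bigID (fun g : {ffun 'I_f -> T} => injectiveb g)) /=.
  by rewrite lerDl sumr_ge0// => g _; apply: prodr_ge0.
rewrite (partition_big im (fun A : {set T} => #|A| == f)) //=.
rewrite mulr_sumr; apply: ler_sum => A /eqP cA.
rewrite [leRHS](eq_bigr (fun _ => \prod_(k in A) a k)); last first.
  move=> g /andP[/injectiveP ig /eqP <-].
  by rewrite big_imset//= => i j _ _; apply: ig.
rewrite sumr_const -[leRHS]mulr_natl ler_wpM2r ?prodr_ge0// ler_nat.
have -> : f`! = #|A| ^_ #|'I_f| by rewrite card_ord cA ffactnn.
rewrite -card_inj_ffuns_on.
apply: subset_leq_card; apply/fintype.subsetP => g; rewrite !inE => /andP[gA ig].
apply/andP; split=> //; rewrite eqEcard cA (eqP (inj_im g ig)) leqnn andbT.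
by apply/fintype.subsetP => _ /imsetP[i _ ->]; apply: (ffun_onP gA).
Qed.

(* Replacing draws without replacement by independent ones costs only a factor 2:
   f independent draws are distinct with probability at least 1/2. *)
Lemma card_draws_ge (R : realType) (N f : nat) : (2 * f ^ 2 <= N)%N ->
  N%:R ^+ f / 2 <= f`!%:R * 'C(N, f)%:R :> R.
Proof.
move=> fN; rewrite -natrM mulnC bin_ffact.
(* Each factor of the falling factorial loses at most the fraction f/N of [N]. At k = f the losses
   total f^2/N <= 1/2. *)
suff H : forall k, (k <= f)%N ->
    N%:R ^+ k * (1 - (k * f)%:R / N%:R) <= (N ^_ k)%:R :> R.
  apply: le_trans (H f (leqnn f)); apply: ler_wpM2l; first exact: exprn_ge0.
  have [->|N0] := posnP N; first by rewrite invr0 mulr0 subr0 invf_le1// ler1n.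
  rewrite lerBrDl -lerBrDr ler_pdivrMr ?ltr0n//.
  have -> : (1 - 2^-1 : R) = 2^-1 by field.
  rewrite ler_pdivlMl// -natrM ler_nat; exact: fN.
have [->|N0] := posnP N.
  case=> [|k] _; first by rewrite expr0 mul1r ffactn0 invr0 mulr0 subr0.
  by rewrite expr0n mul0r.
elim=> [|k IH] kf; first by rewrite mul0n mul0r subr0 mulr1 expr0 ffactn0.
have fN' : (f <= N)%N by apply: leq_trans fN; case: (f) => // m; rewrite expnS expn1; nia.
rewrite ffactnSr [leRHS]natrM natrB ?(leq_trans (ltnW kf))// exprSr.
apply: le_trans (_ : N%:R ^+ k * (1 - (k * f)%:R / N%:R) * (N%:R - k%:R) <= _).
  rewrite -!mulrA ler_wpM2l ?exprn_ge0//.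
  have N0' : (0 : R) < N%:R by rewrite ltr0n.
  have -> : N%:R * (1 - (k.+1 * f)%:R / N%:R) = N%:R - (k%:R + 1) * f%:R :> R.
    by rewrite natrM -natr1; field; rewrite gt_eqF.
  have -> : (1 - (k * f)%:R / N%:R) * (N%:R - k%:R)
     = N%:R - k%:R - k%:R * f%:R + k%:R * f%:R * k%:R / N%:R :> R.
    by rewrite natrM; field; rewrite gt_eqF.
  have k0 : 0 <= k%:R * f%:R * k%:R / N%:R :> R by rewrite divr_ge0 ?mulr_ge0.
  have kf' : k%:R <= f%:R :> R by rewrite ler_nat ltnW.
  lra.
apply: ler_wpM2r; first by rewrite subr_ge0 ler_nat (leq_trans (ltnW kf)).
exact: IH (ltnW kf).
Qed.

(** * Roots of unity and power sums of waves *)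

Section RootOfUnity.
Variable R : realType.
Implicit Types (a b : R) (z : R[i]).

Lemma expiD a b : expi (a + b) = expi a * expi b.
Proof. by rewrite /expi cosD sinD; congr Complex; rewrite addrC. Qed.

Lemma expi0 : expi (0 : R) = 1.
Proof. by rewrite /expi cos0 sin0. Qed.

Lemma expiMn a n : expi (a *+ n) = expi a ^+ n.
Proof. by elim: n => [|n IH]; rewrite ?expi0// mulrS expiD IH exprS. Qed.

Lemma normc_expi a : Normc.normc (expi a) = 1.
Proof. by rewrite /= cos2Dsin2 sqrtr1. Qed.

Lemma normc_sqr z : Normc.normc z ^+ 2 = complex.Re z ^+ 2 + complex.Im z ^+ 2.
Proof. by case: z => a b /=; rewrite sqr_sqrtr ?addr_ge0 ?sqr_ge0. Qed.

Lemma normc_ge0 z : 0 <= Normc.normc z.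
Proof. by case: z => a b; apply: sqrtr_ge0. Qed.

Lemma normcX z n : Normc.normc (z ^+ n) = Normc.normc z ^+ n.
Proof.
elim: n => [|n IH]; first by rewrite !expr0 Normc.normc1.
by rewrite !exprS Normc.normcM IH.
Qed.

Lemma normc_triangle (I : Type) (r : seq I) (P : pred I) (F : I -> R[i]) :
  Normc.normc (\sum_(i <- r | P i) F i) <= \sum_(i <- r | P i) Normc.normc (F i).
Proof.
elim/big_rec2: _ => [|i y z _ IH]; first by rewrite Normc.normc0.
by apply: le_trans (le_normcD _ _) _; rewrite lerD2l.
Qed.

Definition zeta (N : nat) : R[i] := expi (2 * pi / N%:R).

Lemma normc_zetaX N n : Normc.normc (zeta N ^+ n) = 1.
Proof. by rewrite normcX normc_expi expr1n. Qed.

Lemma zetaX N n : zeta N ^+ n = expi (2 * pi * n%:R / N%:R).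
Proof. by rewrite -expiMn -[_ *+ n]mulr_natr mulrAC. Qed.

(** An exponent below [N] giving the value 1 would force [sin (t / 2) = 0] with t/2 strictly between
    0 and pi. *)
Lemma zeta_prim N : (0 < N)%N -> N.-primitive_root (zeta N).
Proof.
move=> N0; have N0' : 0 < N%:R :> R by rewrite ltr0n.
rewrite /primitive_root_of_unity N0; apply/forallP => i; apply/eqP.
rewrite unity_rootE zetaX; have [->|iN] := eqVneq i.+1 N.
  by rewrite mulfK ?(gt_eqF N0')// mulr_natl /expi cos2pi sin2pi !eqxx.
apply/negbTE/eqP; set t := 2 * pi * _ / _ => /(congr1 (@complex.Re R)) /= ct.
have tE : t = (t / 2) *+ 2 by rewrite -mulr_natr; field.
have : sin (t / 2) = 0.
  apply/eqP; rewrite -sqrf_eq0 sin2cos2; apply/eqP.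
  by move: ct; rewrite {1}tE cos_mulr2n -mulr_natr; lra.
have t2E : t / 2 = pi * (i.+1%:R / N%:R) by rewrite /t; field; rewrite gt_eqF.
apply/eqP; rewrite gt_eqF// sin_gt0_pi// t2E.
rewrite mulr_gt0 ?pi_gt0 ?divr_gt0 ?ltr0n//=.
rewrite gtr_pMr ?pi_gt0// ltr_pdivrMr// mul1r ltr_nat.
by rewrite ltn_neqAle iN ltn_ord.
Qed.

(** Subtraction in ['Z_N] wraps around modulo [N], which is harmless because [zeta N] has order
    [N]. *)
Lemma zeta_sub N (t r : 'Z_N) : (1 < N)%N ->
  zeta N ^+ (t - r)%R * zeta N ^+ r = zeta N ^+ t.
Proof.
case: N t r => [|[|n]] t r // _.
rewrite -exprD -(prim_expr_mod (zeta_prim (ltn0Sn n.+1))).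
by congr (_ ^+ _); rewrite -[in RHS](subrK r t).
Qed.

Lemma zeta_eq1 N (t : 'Z_N) : (1 < N)%N -> (zeta N ^+ t == 1) = (t == 0).
Proof.
move=> N1; rewrite -(prim_order_dvd (zeta_prim (ltnW N1))).
have tN : (t < N)%N by rewrite -[X in (_ < X)%N](Zp_cast N1) ltn_ord.
apply/idP/eqP => [|->]; last exact: dvdn0.
have [t0 _|t0 /(dvdn_leq t0)] := posnP t; last by rewrite leqNgt tN.
exact: val_inj.
Qed.

(** The values [zeta N ^+ t], together with 1 for t = 0, are distinct roots of X^j - 1. The cases j
    = 2, 3 count the residues with exceptional thresholds. *)
Lemma zeta_torsion_card N j : (1 < N)%N -> (0 < j)%N ->
  (#|[set t : 'Z_N | t != 0%R & (zeta N ^+ t ^+ j == 1)%R]%SET| < j)%N.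
Proof.
move=> N1 j0; set A := [set _ | _]%SET.
have A0 : 0 \notin A by rewrite inE eqxx.
have := @max_unity_roots _ j [seq zeta N ^+ t | t : 'Z_N <- enum (0 |: A)%SET] j0.
rewrite size_map -cardE cardsU1 A0 add1n; apply.
  apply/allP => _ /mapP[t + ->]; rewrite mem_enum !inE unity_rootE.
  by case/orP => [/eqP ->|/andP[]//]; rewrite expr0 expr1n.
rewrite map_inj_uniq ?enum_uniq// => t r tr; apply/eqP; rewrite -subr_eq0.
rewrite -zeta_eq1//; apply/eqP.
have z0 : zeta N ^+ r != 0.
  by apply/negP => /eqP /(congr1 (@Normc.normc R)); rewrite normc_zetaX Normc.normc0; lra.
by apply: (mulIf z0); rewrite zeta_sub// mul1r.
Qed.

Lemma sum_expr_unity (g : R[i]) (N : nat) :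
  g ^+ N = 1 -> g != 1 -> \sum_(k < N) g ^+ k = 0.
Proof.
move=> gN g1; have := subrX1 g N; rewrite gN subrr => /esym/eqP.
by rewrite mulf_eq0 subr_eq0 (negbTE g1) => /eqP.
Qed.

Lemma Re_sum (I : Type) (r : seq I) (P : pred I) (F : I -> R[i]) :
  complex.Re (\sum_(i <- r | P i) F i) = \sum_(i <- r | P i) complex.Re (F i).
Proof. by elim/big_rec2: _ => [|i y z _ <-]; [|case: (F i); case: z]. Qed.

Lemma sum_Re_wave (w g : R[i]) (N j : nat) : g ^+ N = 1 -> g ^+ j != 1 ->
  \sum_(k < N) complex.Re ((w * g ^+ k) ^+ j) = 0.
Proof.
move=> gN gj; rewrite -Re_sum.
under eq_bigr do rewrite exprMn exprAC.
by rewrite -mulr_sumr sum_expr_unity ?mulr0// exprAC gN expr1n.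
Qed.

(** This double-angle formula and the triple-angle formula [Re_cubeE] reduce moments of a wave to
    sums that [sum_Re_wave] evaluates. *)
Lemma Re_sqrE z : complex.Re z ^+ 2 = (complex.Re (z ^+ 2) + Normc.normc z ^+ 2) / 2.
Proof. by rewrite normc_sqr; case: z => a b /=; field. Qed.

Lemma Re_cubeE z :
  complex.Re z ^+ 3 = (complex.Re (z ^+ 3) + 3 * Normc.normc z ^+ 2 * complex.Re z) / 4.
Proof. by rewrite normc_sqr; case: z => a b /=; field. Qed.

End RootOfUnity.

(** * Exponential moments and the Chernoff bound *)

(** The quartic bound is summed termwise: the linear term vanishes, and [|c k| <= 1] lets the second
    moment bound the fourth. Then 1 + x <= exp x. *)
Lemma sum_expR_le (R : realType) (T : finType) (c : T -> R) (u p q : R) :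
  0 <= u <= 1 -> (forall k, `|c k| <= 1) ->
  \sum_k c k = 0 -> \sum_k c k ^+ 2 <= p * #|T|%:R ->
  \sum_k c k ^+ 3 <= q * #|T|%:R ->
  \sum_k expR (u * c k) <=
    #|T|%:R * expR (p * u ^+ 2 / 2 + q * u ^+ 3 / 6 + p * u ^+ 4 / 18).
Proof.
move=> /andP[u0 u1] c1 m1 m2 m3.
have c1' k : - 1 <= c k <= 1 by rewrite -ler_norml.
apply: le_trans (_ : \sum_k (1 + u * c k + u ^+ 2 / 2 * c k ^+ 2 +
    u ^+ 3 / 6 * c k ^+ 3 + u ^+ 4 / 18 * c k ^+ 2) <= _).
  apply: ler_sum => k _; have /andP[ck0 ck1] := c1' k.
  have uc : u * c k <= 1 by nra.
  apply: le_trans (expR_le_quartic uc) _; rewrite !exprMn.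
  have u4 : 0 <= u ^+ 4 by exact: exprn_ge0.
  have c4 : c k ^+ 4 <= c k ^+ 2.
    rewrite (_ : 4 = 2 + 2)%N// exprD ler_piMr ?sqr_ge0//.
    by rewrite -real_normK ?num_real// exprn_ile1.
  have := ler_wpM2l u4 c4; lra.
rewrite !big_split /= -!mulr_sumr m1 mulr0 addr0 sumr_const.
apply: le_trans (_ : #|T|%:R * (1 + (p * u ^+ 2 / 2 + q * u ^+ 3 / 6 + p * u ^+ 4 / 18)) <= _).
  have a2 := ler_wpM2l (exprn_ge0 2 u0) m2.
  have a3 := ler_wpM2l (exprn_ge0 3 u0) m3.
  have a4 := ler_wpM2l (exprn_ge0 4 u0) m2.
  lra.
by apply: ler_wpM2l => //; apply: expR_ge1Dx.
Qed.

(* psi bounds the log-moment generating function of one draw. *)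
Lemma draws_chernoff (R : realType) (T : finType) (c : T -> R) (u a psi : R)
    (f : nat) :
  0 <= u -> (2 * f ^ 2 <= #|T|)%N ->
  \sum_k expR (u * c k) <= #|T|%:R * expR psi ->
  #|[set A : {set T} | #|A| == f & a * f%:R <= \sum_(k in A) c k]%SET|%:R <=
    2 * expR (- (f%:R * (u * a - psi))) * 'C(#|T|, f)%:R.
Proof.
move=> u0 fT mgf; set E := [set _ | _]%SET.
have f0 : 0 < f`!%:R :> R by rewrite ltr0n fact_gt0.
(* Markov's inequality: each set in [E] contributes at least [expR (f%:R * (u * a))]. *)
have lb : #|E|%:R * expR (f%:R * (u * a)) <=
    \sum_(A : {set T} | #|A| == f) \prod_(k in A) expR (u * c k).
  rewrite mulrC mulr_natr -sumr_const.
  rewrite [leRHS](bigID (fun A => A \in E)) /= -[leLHS]addr0 lerD//; last first.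
    by apply: sumr_ge0 => A _; apply: prodr_ge0 => k _; exact: expR_ge0.
  rewrite [leRHS](eq_bigl (fun A => A \in E)); last first.
    by move=> A; rewrite inE; case: (_ == f).
  apply: ler_sum => A; rewrite inE => /andP[_ aA].
  rewrite -expR_sum ler_expR -mulr_sumr mulrCA ler_wpM2l// mulrC//.
have ub := sum_prod_draws f (fun k => expR_ge0 (u * c k)).
have ub2 : (\sum_k expR (u * c k)) ^+ f <= (#|T|%:R * expR psi) ^+ f.
  apply: lerXn2r => //; rewrite nnegrE ?mulr_ge0 ?expR_ge0//.
  by apply: sumr_ge0 => k _; exact: expR_ge0.
(* This trades N^f / f! for twice the binomial coefficient, where N is the cardinality of [T]. *)
have cg := card_draws_ge R fT.
rewrite -(ler_pM2r (expR_gt0 (f%:R * (u * a)))) -(ler_pM2l f0).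
have := le_trans (ler_wpM2l (ltW f0) lb) (le_trans ub ub2).
move=> /le_trans; apply; rewrite exprMn -expRM_natl.
have -> : expR (f%:R * psi) = expR (- (f%:R * (u * a - psi))) * expR (f%:R * (u * a)).
  by rewrite -expRD; congr expR; ring.
have := ler_wpM2r (ltW (mulr_gt0 (expR_gt0 (- (f%:R * (u * a - psi))))
  (expR_gt0 (f%:R * (u * a))))) cg.
lra.
Qed.

(** * Moments of waves, and a finite net of directions *)

Section Waves.
Variable R : realType.

Lemma Re_le_normc (z : R[i]) : `|complex.Re z| <= Normc.normc z.
Proof.
rewrite -ler_sqr ?nnegrE ?normc_ge0// normc_sqr real_normK ?num_real//.
by rewrite lerDl sqr_ge0.
Qed.

(* p and q bound the second and the third moment of Re (w zeta^(t k)). *)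
Lemma wave_mgf (N : nat) (t : 'Z_N) (w : R[i]) (u : R) (g := zeta R N ^+ t)
    (p : R := if g ^+ 2 == 1 then 1 else 2^-1)
    (q : R := if g ^+ 3 == 1 then p else 0) :
  (1 < N)%N -> t != 0 -> Normc.normc w <= 1 -> 0 <= u <= 1 ->
  \sum_(k : 'Z_N) expR (u * complex.Re (w * zeta R N ^+ (t * k)%N)) <=
    N%:R * expR (p * u ^+ 2 / 2 + q * u ^+ 3 / 6 + p * u ^+ 4 / 18).
Proof.
move=> N1 t0 w1 u01.
have gN : g ^+ N = 1 by rewrite /g exprAC (prim_expr_order (zeta_prim R (ltnW N1))) expr1n.
have g1 : g ^+ 1 != 1 by rewrite expr1 zeta_eq1.
have cZ : #|'Z_N| = N by rewrite card_ord Zp_cast.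
have normz (k : nat) : Normc.normc (w * g ^+ k) = Normc.normc w.
  by rewrite Normc.normcM /g -exprM normc_zetaX mulr1.
have wave0 j : g ^+ j != 1 -> \sum_(k : 'Z_N) complex.Re ((w * g ^+ k) ^+ j) = 0.
  move=> gj; rewrite -[RHS](sum_Re_wave w gN gj).
  by rewrite -!(big_mkord xpredT (fun k => complex.Re ((w * g ^+ k) ^+ j))) Zp_cast.
have wsq : Normc.normc w ^+ 2 <= 1 by rewrite exprn_ile1// normc_ge0.
pose c (k : 'Z_N) := complex.Re (w * g ^+ k).
have c1 k : `|c k| <= 1 by rewrite (le_trans (Re_le_normc _))// normz.
have csq k : c k ^+ 2 <= 1 by rewrite -real_normK ?num_real// exprn_ile1.
have m1 : \sum_k c k = 0 by rewrite -[RHS](wave0 1%N g1).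
(* The second harmonic sums to zero unless [g ^+ 2 = 1]; in that case only [|c k| <= 1] is
   available. *)
have m2 : \sum_k c k ^+ 2 <= p * #|'Z_N|%:R.
  rewrite -sumr_const mulr_sumr /p; case: eqP => [_|/eqP g2].
    by apply: ler_sum => k _; rewrite mulr1 csq.
  rewrite mulr1; apply: le_trans
    (_ : \sum_(k : 'Z_N) (2^-1 + complex.Re ((w * g ^+ k) ^+ 2) / 2) <= _); last first.
    by rewrite big_split /= -mulr_suml wave0// mul0r addr0.
  apply: ler_sum => k _; rewrite /c Re_sqrE normz; move: wsq; lra.
(* If [g ^+ 3 != 1], the third and first harmonics both sum to zero; otherwise c^3 <= c^2 gives back
   the second moment. *)
have m3 : \sum_k c k ^+ 3 <= q * #|'Z_N|%:R.
  rewrite /q; case: eqP => [_|/eqP g3].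
    apply: le_trans m2; apply: ler_sum => k _.
    rewrite exprSr ler_piMr ?sqr_ge0//; exact: le_trans (ler_norm _) (c1 k).
  rewrite mul0r; under eq_bigr => k _ do rewrite /c Re_cubeE normz mulrDl mulrAC.
  by rewrite big_split /= -mulr_suml wave0// -mulr_sumr -/(c _) m1 mul0r mulr0 addr0.
have := sum_expR_le u01 c1 m1 m2 m3; rewrite cZ; apply: le_trans.
by apply: ler_sum => k _; rewrite /c /g -exprM.
Qed.

(** A grid of spacing 1/M on the square [-1, 1]^2, indexed by a finite type for the union bound. Its
    corners lie outside the unit disc, so norm at most 1 is a separate condition below. *)
Definition direction (M : nat) (d : 'I_(2 * M).+1 * 'I_(2 * M).+1) : R[i] :=
  Complex ((d.1%:R - M%:R) / M%:R) ((d.2%:R - M%:R) / M%:R).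

(* Rounding towards zero keeps the approximating vector in the unit disc. *)
Lemma grid_round (M : nat) (x : R) : (0 < M)%N -> `|x| <= 1 ->
  exists i : 'I_(2 * M).+1, let a := (i%:R - M%:R) / M%:R in
    a ^+ 2 <= x ^+ 2 /\ x ^+ 2 - `|x| / M%:R <= a * x.
Proof.
move=> M0 x1; have M0' : 0 < M%:R :> R by rewrite ltr0n.
have Mx0 : 0 <= M%:R * `|x| by rewrite mulr_ge0.
have /andP[] := truncn_itv Mx0; set n := Num.truncn _ => n1 n2.
have nM : (n <= M)%N.
  by rewrite -(ler_nat R) (le_trans n1)// ler_piMr.
have n1' : n%:R / M%:R <= `|x| by rewrite ler_pdivrMr// mulrC.
have n2' : `|x| - M%:R^-1 <= n%:R / M%:R.
  by rewrite lerBlDr -[X in _ + X]mul1r -mulrDl natr1 ler_pdivlMr// mulrC ltW.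
have nn0 : 0 <= n%:R / M%:R :> R by rewrite divr_ge0.
have sq : (n%:R / M%:R) ^+ 2 <= x ^+ 2.
  by rewrite -(real_normK (num_real x)) lerXn2r// nnegrE.
have lin : x ^+ 2 - `|x| / M%:R <= (n%:R / M%:R) * `|x|.
  rewrite -(real_normK (num_real x)) expr2.
  by have := ler_wpM2r (normr_ge0 x) n2'; lra.
have [x0|x0] := leP 0 x.
  have iP : (M + n < (2 * M).+1)%N by rewrite ltnS mul2n -addnn leq_add2l.
  exists (Ordinal iP) => /=; rewrite natrD addrAC subrr add0r.
  by split=> //; rewrite (le_trans lin)// ger0_norm.
have iP : (M - n < (2 * M).+1)%N.
  by rewrite ltnS (leq_trans (leq_subr _ _))// leq_pmull.
exists (Ordinal iP) => /=; rewrite natrB// addrAC subrr add0r mulNr sqrrN.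
by split=> //; rewrite (le_trans lin)// ltr0_norm// mulrN mulNr.
Qed.

(** Rounding the conjugate of z/|z| to the grid loses at most 1/M per coordinate. Finitely many real
    projections thus control the modulus. *)
Lemma direction_dense (M : nat) (z : R[i]) : (0 < M)%N ->
  exists2 d : 'I_(2 * M).+1 * 'I_(2 * M).+1, Normc.normc (direction d) <= 1 &
    Normc.normc z * (1 - 2 / M%:R) <= complex.Re (direction d * z).
Proof.
move=> M0; have M0' : 0 < M%:R :> R by rewrite ltr0n.
set r := Normc.normc z; have r0 : 0 <= r by exact: normc_ge0.
(* The sign of [y] comes from the conjugate. For z = 0 the quotients are 0 by convention, and both
   sides of the goal vanish. *)
pose x := complex.Re z / r; pose y := - (complex.Im z / r).
have rE : r ^+ 2 = complex.Re z ^+ 2 + complex.Im z ^+ 2 by rewrite normc_sqr.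
have xr : complex.Re z = x * r.
  rewrite /x; have [r_0|rn0] := eqVneq r 0; last by rewrite divfK.
  by rewrite r_0 mulr0; move: rE; rewrite r_0; nra.
have yr : complex.Im z = - y * r.
  rewrite /y opprK; have [r_0|rn0] := eqVneq r 0; last by rewrite divfK.
  by rewrite r_0 mulr0; move: rE; rewrite r_0; nra.
have xy : x ^+ 2 + y ^+ 2 <= 1 /\ (r = 0 \/ x ^+ 2 + y ^+ 2 = 1).
  have [r_0|rn0] := eqVneq r 0.
    by rewrite /x /y r_0 invr0 !mulr0 oppr0 expr0n /= addr0; split; [exact: ler01|left].
  have xy1 : x ^+ 2 + y ^+ 2 = 1.
    by rewrite /x /y sqrrN !exprMn -mulrDl -rE exprVn divff// expf_neq0.
  by rewrite xy1; split; [|right].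
case: xy => xy1 xyr.
have norm1 (v : R) : v ^+ 2 <= 1 -> `|v| <= 1.
  by move=> v1; rewrite -(@ler_pXn2r _ 2) ?nnegrE// expr1n real_normK ?num_real.
have x1 : `|x| <= 1 by apply: norm1; have := sqr_ge0 y; lra.
have y1 : `|y| <= 1 by apply: norm1; have := sqr_ge0 x; lra.
have [i [i1 i2]] := grid_round M0 x1.
have [j [j1 j2]] := grid_round M0 y1.
exists (i, j).
  rewrite -(@ler_pXn2r _ 2) ?nnegrE ?normc_ge0// expr1n normc_sqr /=.
  by apply: le_trans xy1; apply: lerD.
have -> : complex.Re (direction (i, j) * z) =
    ((i%:R - M%:R) / M%:R * x + (j%:R - M%:R) / M%:R * y) * r.
  have -> : complex.Re (direction (i, j) * z) = (i%:R - M%:R) / M%:R * complex.Re z -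
      (j%:R - M%:R) / M%:R * complex.Im z by case: (z).
  by rewrite xr yr; ring.
rewrite mulrC; case: xyr => [->|xy]; first by rewrite !mulr0.
apply: ler_wpM2r => //.
have := lerD i2 j2; have := ler_wpM2r (ltW (divr_gt0 ltr01 M0')) x1.
have := ler_wpM2r (ltW (divr_gt0 ltr01 M0')) y1.
lra.
Qed.

End Waves.

(** * Deterministic recovery from small character sums *)

Section Recovery.
Variable R : realType.

(** Up to scaling, the inverse Fourier transform of the indicator function of [Omega]. *)
Definition charsum (N : nat) (Omega : {set 'Z_N}) (t : 'Z_N) : R[i] :=
  \sum_(k in Omega) zeta R N ^+ (t * k)%N.

Lemma dftE (N : nat) (x : {ffun 'Z_N -> R[i]}) (k : 'Z_N) :
  dft x k = real_complex R (Num.sqrt N%:R)^-1 *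
    \sum_(r : 'Z_N) x r / zeta R N ^+ (r * k)%N.
Proof.
rewrite ffunE; congr (_ * _); apply: eq_bigr => r _; congr (_ * _).
rewrite zetaX; set th := 2 * pi * _ / _.
have e1 : expi (- th) * expi th = 1 by rewrite -expiD addNr expi0.
have e0 : expi th != 0 by apply: contra_eq_neq e1 => ->; rewrite mulr0 eq_sym oner_neq0.
by apply: (mulIf e0); rewrite e1 mulVf.
Qed.

(** After exchanging the sums, each k in [Omega] contributes [zeta R N ^+ (t * k)] times the
    unscaled transform of y - x at k, which is zero. *)
Lemma charsum_annihilates (N : nat) (Omega : {set 'Z_N}) (x y : {ffun 'Z_N -> R[i]})
    (t : 'Z_N) : (1 < N)%N ->
  (forall k, k \in Omega -> dft y k = dft x k) ->
  \sum_(r : 'Z_N) (y r - x r) * charsum Omega (t - r) = 0.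
Proof.
move=> N1 xy.
have sN : real_complex R (Num.sqrt N%:R)^-1 != 0.
  rewrite -(rmorph0 (real_complex R)) (inj_eq (@complexI _)).
  by rewrite invr_eq0 sqrtr_eq0 -ltNge ltr0n ltnW.
have z0 r : zeta R N ^+ r != 0.
  by apply/negP => /eqP /(congr1 (@Normc.normc R)); rewrite normc_zetaX Normc.normc0; lra.
have xy' k : k \in Omega ->
    \sum_(r : 'Z_N) (y r - x r) / zeta R N ^+ (r * k)%N = 0.
  move=> kO; have := xy k kO; rewrite !dftE => /(mulfI sN)/eqP.
  rewrite -subr_eq0 -sumrB => /eqP e.
  by rewrite -[RHS]e; apply: eq_bigr => r _; rewrite mulrBl.
under eq_bigr => r _ do rewrite /charsum mulr_sumr.
rewrite exchange_big /= big1// => k kO.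
transitivity ((\sum_(r : 'Z_N) (y r - x r) / zeta R N ^+ (r * k)%N) *
  zeta R N ^+ (t * k)%N); last by rewrite xy'// mul0r.
rewrite mulr_suml; apply: eq_bigr => r _; rewrite -mulrA; congr (_ * _).
by rewrite !exprM -(@zeta_sub R N t r)// exprMn mulrC mulfK// -exprM z0.
Qed.

(** Let P and Q be the l1 masses of y - x on and off the support of [x]. Summing the pointwise bound
    [zt] over the support gives P <= B' P + B Q, so B + B' < 1 yields P < Q. *)
Lemma coherence_recovery (N s : nat) (Omega : {set 'Z_N}) (tau : 'Z_N -> R)
    (B B' : R) (x : {ffun 'Z_N -> R[i]}) :
  (1 < N)%N -> (0 < #|Omega|)%N -> (forall t, 0 <= tau t) ->
  (forall t, t != 0 -> Normc.normc (charsum Omega t) <= #|Omega|%:R * tau t) ->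
  (forall T : {set 'Z_N}, 0 \notin T -> (#|T| <= s)%N -> \sum_(t in T) tau t <= B) ->
  (forall T : {set 'Z_N}, 0 \notin T -> (#|T| < s)%N -> \sum_(t in T) tau t <= B') ->
  B + B' < 1 -> (l0norm x <= s)%N -> unique_min_extension Omega x.
Proof.
move=> N1 O0 tau0 small hB hB' BB' xs y yx xy.
have O0' : 0 < #|Omega|%:R :> R by rewrite ltr0n.
pose nz (t : 'Z_N) : R := Normc.normc (y t - x t).
have nz0 t : 0 <= nz t by exact: normc_ge0.
have B0 : 0 <= B.
  by have := hB (@finset.set0 _); rewrite inE cards0 big_set0 => /(_ isT isT).
have zt (t : 'Z_N) : nz t <= \sum_(r | r != t) nz r * tau (t - r).
  have := charsum_annihilates t N1 xy; rewrite (bigD1 t)//= subrr.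
  have -> : charsum Omega 0 = #|Omega|%:R.
    by rewrite /charsum (eq_bigr (fun=> 1)) ?sumr_const// => k _; rewrite mul0n expr0.
  move/eqP; rewrite addr_eq0 => /eqP /(congr1 (@Normc.normc R)).
  rewrite normcN Normc.normcM -/(nz t).
  have -> : Normc.normc #|Omega|%:R = #|Omega|%:R :> R.
    by rewrite normcMn Normc.normc1.
  move=> e; rewrite -(ler_pM2r O0') e; apply: le_trans (normc_triangle _ _ _) _.
  rewrite mulr_suml; apply: ler_sum => r rt; rewrite Normc.normcM -mulrA.
  apply: ler_wpM2l; first exact: nz0.
  by rewrite mulrC small// subr_eq0 eq_sym.
pose S := [set t | x t != 0]%SET.
have Sx (t : 'Z_N) : t \notin S -> x t = 0 by rewrite inE negbK => /eqP.
pose P := \sum_(t in S) nz t; pose Q := \sum_(t | t \notin S) nz t.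
have P0 : 0 <= P by exact: sumr_ge0.
have Q0 : 0 <= Q by exact: sumr_ge0.
(* The nonzero differences t - r with t in the support: at most [s] of them, and fewer than [s] when
   r itself lies there. *)
pose T (r : 'Z_N) := ((fun t => t - r) @: (S :\ r))%SET.
have Tsum r : \sum_(t in S | r != t) tau (t - r) = \sum_(t in T r) tau t.
  rewrite big_imset /=; last by move=> a b _ _ /addIr.
  by apply: eq_bigl => t; rewrite !inE andbC eq_sym.
have T0 r : 0 \notin T r.
  by apply/imsetP => -[t]; rewrite !inE => /andP[tr _] /esym/eqP; rewrite subr_eq0 (negbTE tr).
have TB r : \sum_(t in S | r != t) tau (t - r) <= B.
  rewrite Tsum hB//; apply: leq_trans xs; apply: leq_trans (leq_imset_card _ _) _.
  by rewrite subset_leq_card// subD1set.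
have TB' r : r \in S -> \sum_(t in S | r != t) tau (t - r) <= B'.
  move=> rS; rewrite Tsum hB'//; apply: leq_trans xs.
  apply: leq_ltn_trans (leq_imset_card _ _) _.
  by rewrite [X in (_ < X)%N](cardsD1 r) rS.
have key : P <= B' * P + B * Q.
  apply: le_trans (_ : \sum_(t in S) \sum_(r | r != t) nz r * tau (t - r) <= _).
    by apply: ler_sum => t _; exact: zt.
  rewrite (exchange_big_dep xpredT)//= (bigID (fun r => r \in S)) /= !mulr_sumr.
  apply: lerD; apply: ler_sum => r rS; rewrite -mulr_sumr mulrC ler_wpM2r//.
  exact: TB'.
have PQ0 : 0 < P + Q.
  rewrite lt_neqAle addr_ge0// andbT eq_sym; apply/eqP => PQ.
  apply: yx; apply/ffunP => t; apply/eqP; rewrite -subr_eq0; apply/eqP.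
  apply: Normc.eq0_normc; apply/eqP; rewrite -/(nz t).
  have: \sum_t nz t = 0 by rewrite (bigID (fun r => r \in S)).
  by move/psumr_eq0P => /(_ (fun i _ => nz0 i)) ->.
have PQ : P < Q by nra.
rewrite /l1norm.
have -> : \sum_t Normc.normc (x t) = \sum_(t in S) Normc.normc (x t).
  rewrite (bigID (fun r => r \in S)) /= [X in _ + X]big1 ?addr0// => t tS.
  by rewrite Sx// Normc.normc0.
rewrite [ltRHS](bigID (fun r => r \in S)) /=.
have -> : \sum_(t | t \notin S) Normc.normc (y t) = Q.
  by apply: eq_bigr => t tS; rewrite /nz Sx// subr0.
(* Passing from [x] to [y] lowers the mass on the support by at most P, while Q > P appears outside
   it. *)
have : \sum_(t in S) Normc.normc (x t) <= \sum_(t in S) Normc.normc (y t) + P.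
  rewrite -big_split /=; apply: ler_sum => t _.
  by have := le_normcD (y t) (- (y t - x t)); rewrite normcN subKr.
lra.
Qed.

End Recovery.

(** * Thresholds and the choice of the Chernoff parameter *)

Section Sampling.
Variable R : realType.

(* The threshold tau: 0.5/s in general, 0.708/s if 2 t = 0 (0.708 > 1/sqrt 2 is
   needed for variance 1), 0.52/s if 3 t = 0. The extra 0.208 + 2 * 0.02 is less
   than 1/4, which is what coherent_recovery requires. *)
Definition coherence_bound (N s : nat) (t : 'Z_N) : R :=
  (2 * s%:R)^-1 + (if zeta R N ^+ t ^+ 2 == 1 then 26 / (125 * s%:R) else 0)
  + (if zeta R N ^+ t ^+ 3 == 1 then (50 * s%:R)^-1 else 0).

Lemma coherence_bound_ge0 N s (t : 'Z_N) : 0 <= coherence_bound s t.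
Proof.
have h (c : R) (b : bool) : 0 <= c -> 0 <= (if b then c else 0) by case: b.
by rewrite !addr_ge0 ?h ?divr_ge0 ?invr_ge0 ?mulr_ge0.
Qed.

(** At most one nonzero t satisfies 2 t = 0 and at most two satisfy 3 t = 0; 31/125 is 26/125 +
    2/50. *)
Lemma sum_coherence_bound N s (T : {set 'Z_N}) : (1 < N)%N -> (0 < s)%N ->
  0 \notin T ->
  \sum_(t in T) coherence_bound s t <= #|T|%:R / (2 * s%:R) + 31 / (125 * s%:R).
Proof.
move=> N1 s0 T0; have s0' : 0 < s%:R :> R by rewrite ltr0n.
have tors j (c : R) : (0 < j)%N -> 0 <= c ->
    \sum_(t in T) (if zeta R N ^+ t ^+ j == 1 then c else 0) <= j.-1%:R * c.
  move=> j0 c0; rewrite -big_mkcondr sumr_const -[leLHS]mulr_natl ler_wpM2r// ler_nat.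
  rewrite -ltnS prednK//; apply: leq_ltn_trans (zeta_torsion_card R N1 j0).
  apply: subset_leq_card; apply/fintype.subsetP => t; rewrite !inE => /andP[tT ->].
  by rewrite andbT; apply: contraNneq T0 => <-.
rewrite !big_split /= sumr_const -[_ *+ #|_|]mulr_natl.
have t2 := @tors 2%N (26 / (125 * s%:R)) isT; have t3 := @tors 3%N (50 * s%:R)^-1 isT.
have p2 : 0 <= 26 / (125 * s%:R) :> R by rewrite divr_ge0// mulr_ge0.
have p3 : 0 <= (50 * s%:R)^-1 :> R by rewrite invr_ge0 mulr_ge0.
have e : 31 / (125 * s%:R) = 1 * (26 / (125 * s%:R)) + 2 * (50 * s%:R)^-1 :> R.
  by field; rewrite gt_eqF.
by rewrite e -addrA lerD2l lerD// ?t2 ?t3.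
Qed.

(* Projecting on finitely many directions multiplies the thresholds by 1 - 2/mesh;
   this loss is covered by the s^2 + 1, instead of s^2, in the sample size. *)
Definition mesh (s : nat) := (100 * (s ^ 2 + 1))%N.

(** Maximizing u tau - p u^2/2 suggests u = tau/p, with gain tau^2/(2p), that is 1/(4 s^2) in the
    generic case. For 3 t = 0 this would be 1.04/s, replaced by 1/s to keep u <= 1. *)
Lemma chernoff_exponent N s (t : 'Z_N) (g := zeta R N ^+ t)
    (p : R := if g ^+ 2 == 1 then 1 else 2^-1)
    (q : R := if g ^+ 3 == 1 then p else 0) :
  (1 < N)%N -> (0 < s)%N -> t != 0 ->
  exists2 u : R, 0 <= u <= 1 &
    1 <= 4 * (s ^ 2 + 1)%:R *
      (u * (coherence_bound s t * (1 - 2 / (mesh s)%:R)) -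
       (p * u ^+ 2 / 2 + q * u ^+ 3 / 6 + p * u ^+ 4 / 18)).
Proof.
move=> N1 s0 t0; pose v : R := s%:R^-1.
have s0' : 0 < s%:R :> R by rewrite ltr0n.
have v0 : 0 < v by rewrite invr_gt0.
have v1 : v <= 1 by rewrite invf_le1// ler1n.
(* With v = 1/s the factor s^2 cancels and a polynomial in v remains; its last term is the loss from
   the mesh. *)
have reduce (a b : R) (pp qq : R) :
    4 * (s ^ 2 + 1)%:R * (v * a * (v * b * (1 - 2 / (mesh s)%:R)) -
       (pp * (v * a) ^+ 2 / 2 + qq * (v * a) ^+ 3 / 6 + pp * (v * a) ^+ 4 / 18)) =
    4 * (1 + v ^+ 2) * (a * b - (pp * a ^+ 2 / 2 + qq * a ^+ 3 * v / 6 +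
       pp * a ^+ 4 * v ^+ 2 / 18)) - 2 / 25 * a * b * v ^+ 2.
  rewrite /mesh natrM natrD natrX /v; field.
  by rewrite !gt_eqF//= addr_gt0 ?exprn_gt0.
have v2 : v ^+ 2 <= 1 by rewrite exprn_ile1// ltW.
have [g2|g2] := boolP (g ^+ 2 == 1).
  have g3 : (g ^+ 3 == 1) = false.
    by rewrite exprS (eqP g2) mulr1 zeta_eq1//; exact/negbTE.
  exists (v * (177 / 250)); first by apply/andP; split; nra.
  rewrite /q /p g2 g3.
  have -> : coherence_bound s t = v * (177 / 250).
    by rewrite /coherence_bound -/g g2 g3 /v; field; rewrite gt_eqF.
  by rewrite reduce; nra.
have [g3|g3] := boolP (g ^+ 3 == 1).
  exists (v * 1); first by apply/andP; split; nra.
  rewrite /q /p (negbTE g2) g3.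
  have -> : coherence_bound s t = v * (13 / 25).
    by rewrite /coherence_bound -/g (negbTE g2) g3 /v; field; rewrite gt_eqF.
  rewrite reduce.
  have v3 : v ^+ 3 <= v ^+ 2 by rewrite exprSr ler_piMr ?sqr_ge0.
  have v4 : v ^+ 4 <= v ^+ 2 by rewrite (exprD _ 2 2) ler_piMr ?sqr_ge0.
  (* 17/50 is close to the minimizer of the quadratic in v that is left. *)
  by have := sqr_ge0 (v - 17 / 50); lra.
exists (v * 1); first by apply/andP; split; nra.
rewrite /q /p (negbTE g2) (negbTE g3).
have -> : coherence_bound s t = v * 2^-1.
  by rewrite /coherence_bound -/g (negbTE g2) (negbTE g3) /v; field; rewrite gt_eqF.
rewrite reduce.
have v4 : v ^+ 4 <= v ^+ 2 by rewrite (exprD _ 2 2) ler_piMr ?sqr_ge0.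
have := sqr_ge0 v; lra.
Qed.

(** * Bad samples and the union bound *)

Definition bad_samples (N s f : nat) (t : 'Z_N)
    (d : 'I_(2 * mesh s).+1 * 'I_(2 * mesh s).+1) : {set {set 'Z_N}} :=
  [set A : {set 'Z_N} | #|A| == f &
     coherence_bound s t * (1 - 2 / (mesh s)%:R) * f%:R <=
     \sum_(k in A) complex.Re (direction R d * zeta R N ^+ (t * k)%N)]%SET.

(** With [u] from [chernoff_exponent], the lower bound on [f] makes the Chernoff exponent at least C
    L; [L] will be [ln N%:R]. *)
Lemma card_bad_samples N s f (L C : R) (t : 'Z_N) d :
  (1 < N)%N -> (0 < s)%N -> t != 0 -> Normc.normc (direction R d) <= 1 ->
  (2 * f ^ 2 <= N)%N -> 0 <= C * L -> 4 * C * (s ^ 2 + 1)%:R * L <= f%:R ->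
  #|@bad_samples N s f t d|%:R <= 2 * expR (- (C * L)) * 'C(N, f)%:R.
Proof.
move=> N1 s0 t0 d1 fN CL Lf.
have cZ : #|'Z_N| = N by rewrite card_ord Zp_cast.
have [u u01 ue] := @chernoff_exponent N s t N1 s0 t0.
have mgf := wave_mgf N1 t0 d1 u01.
move: ue mgf; set psi := (_ + _ + _ : R); set a := _ * (1 - _) => ue mgf.
have /andP[u0 _] := u01.
have := @draws_chernoff R 'Z_N (fun k => complex.Re (direction R d * zeta R N ^+ (t * k)%N))
  u a psi f u0; rewrite cZ => /(_ fN mgf) /le_trans; apply.
rewrite ler_wpM2r// ler_wpM2l// ler_expR lerN2.
have e0 : 0 < u * a - psi.
  rewrite -(pmulr_rgt0 _ (_ : 0 < 4 * (s ^ 2 + 1)%:R)); first exact: lt_le_trans ue.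
  by rewrite mulr_gt0// ltr0n addn1.
have := ler_wpM2r (ltW e0) Lf; have := ler_wpM2l CL ue; lra.
Qed.

(** If |S(t)| exceeded its threshold, the direction given by [direction_dense] would witness that
    [A] is bad. *)
Lemma not_bad_coherent N s (A : {set 'Z_N}) : (0 < #|A|)%N ->
  (forall t d, t != 0 -> Normc.normc (direction R d) <= 1 ->
     A \notin @bad_samples N s #|A| t d) ->
  forall t, t != 0 -> Normc.normc (charsum R A t) <= #|A|%:R * coherence_bound s t.
Proof.
move=> A0 nbad t t0; rewrite leNgt; apply/negP => big.
have M0 : (0 < mesh s)%N by rewrite muln_gt0 addn1.
have [d d1 dz] := @direction_dense R _ (charsum R A t) M0.
apply/negP: (nbad t d t0 d1); rewrite negbK inE eqxx /=.
have -> : \sum_(k in A) complex.Re (direction R d * zeta R N ^+ (t * k)%N) =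
    complex.Re (direction R d * charsum R A t) by rewrite mulr_sumr Re_sum.
apply: le_trans dz; rewrite mulrAC ler_wpM2r//; last by rewrite mulrC ltW.
rewrite subr_ge0 ler_pdivrMr ?ltr0n// mul1r ler_nat.
by rewrite /mesh mulnDr (leq_trans _ (leq_addl _ _)).
Qed.

Lemma coherent_recovery N s (A : {set 'Z_N}) (x : {ffun 'Z_N -> R[i]}) :
  (1 < N)%N -> (0 < s)%N -> (0 < #|A|)%N ->
  (forall t d, t != 0 -> Normc.normc (direction R d) <= 1 ->
     A \notin @bad_samples N s #|A| t d) ->
  (l0norm x <= s)%N -> unique_min_extension A x.
Proof.
move=> N1 s0 A0 nbad xs; have s0' : 0 < s%:R :> R by rewrite ltr0n.
pose B : R := s%:R / (2 * s%:R) + 31 / (125 * s%:R).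
pose B' : R := (s%:R - 1) / (2 * s%:R) + 31 / (125 * s%:R).
apply: (@coherence_recovery R N s A (@coherence_bound N s) B B' x) => //.
- by move=> t; exact: coherence_bound_ge0.
- exact: not_bad_coherent.
- move=> T T0 Ts; apply: le_trans (sum_coherence_bound N1 s0 T0) _.
  by rewrite lerD2r ler_wpM2r ?invr_ge0 ?mulr_ge0// ler_nat.
- move=> T T0 Ts; apply: le_trans (sum_coherence_bound N1 s0 T0) _.
  by rewrite lerD2r ler_wpM2r ?invr_ge0 ?mulr_ge0// lerBrDr natr1 ler_nat.
(* The margin 1/(250 s) is what remains of 1/(2s) after two exceptional terms 31/(125 s). *)
have -> : B + B' = 1 - (250 * s%:R)^-1 by rewrite /B /B'; field; rewrite gt_eqF.
by rewrite gtrBl invr_gt0 mulr_gt0.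
Qed.

Lemma card_bigcup_le (T I : finType) (P : pred I) (F : I -> {set T}) :
  (#|(\bigcup_(i | P i) F i)%SET| <= \sum_(i | P i) #|F i|)%N.
Proof.
elim/big_rec2: _ => [|i n A _ IH]; first by rewrite cards0.
by apply: leq_trans (leq_card_setU _ _) _; rewrite leq_add2l.
Qed.

(** A union bound over all pairs of a residue and a direction; a draw outside every bad set recovers
    all sparse signals by [coherent_recovery]. *)
Lemma failure_probability N s f (L C : R) :
  (1 < N)%N -> (0 < s)%N -> (0 < f)%N -> (2 * f ^ 2 <= N)%N ->
  0 <= C * L -> 4 * C * (s ^ 2 + 1)%:R * L <= f%:R ->
  1 - 2 * (2 * mesh s).+1%:R ^+ 2 * (N%:R * expR (- (C * L))) <=
  unif_prob R [set A : {set 'Z_N} | #|A| == f]%SET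
    (fun A => forall x : {ffun 'Z_N -> R[i]},
       (l0norm x <= s)%N -> unique_min_extension A x).
Proof.
move=> N1 s0 f0 fN CL Lf.
have cZ : #|'Z_N| = N by rewrite card_ord Zp_cast.
rewrite /unif_prob; set DD := [set A : {set 'Z_N} | _]%SET.
set G := [set A in _ | _]%SET.
have cD : #|DD| = 'C(N, f) by rewrite card_draws cZ.
have fN' : (f <= N)%N by apply: leq_trans fN; rewrite expnS expn1; nia.
have D0 : 0 < #|DD|%:R :> R by rewrite ltr0n cD bin_gt0.
pose D := ('I_(2 * mesh s).+1 * 'I_(2 * mesh s).+1)%type.
pose P (i : 'Z_N * D) := (i.1 != 0) && (Normc.normc (direction R i.2) <= 1).
pose E (i : 'Z_N * D) := @bad_samples N s f i.1 i.2.
have cover : DD \subset (G :|: \bigcup_(i | P i) E i)%SET.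
  apply/fintype.subsetP => A AD; rewrite inE.
  have [|nb] := boolP (A \in (\bigcup_(i | P i) E i)%SET); first by rewrite orbT.
  rewrite orbF inE AD /=; apply/asboolP => x xs.
  move: AD; rewrite inE => /eqP Af.
  apply: (coherent_recovery N1 s0 _ _ xs); rewrite Af// => t d t0 d1.
  apply: contra nb => Ab; apply/bigcupP; exists (t, d) => //.
  by rewrite /P /= t0.
have cardE : #|DD|%:R <= #|G|%:R + \sum_(i | P i) #|E i|%:R :> R.
  rewrite -natr_sum -natrD ler_nat; apply: leq_trans (subset_leq_card cover) _.
  apply: leq_trans (leq_card_setU _ _) _.
  by rewrite leq_add2l card_bigcup_le.
have sumE : \sum_(i | P i) #|E i|%:R <=
    (N%:R * (2 * mesh s).+1%:R ^+ 2) * (2 * expR (- (C * L)) * #|DD|%:R) :> R.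
  apply: le_trans (_ : \sum_(i : 'Z_N * D) 2 * expR (- (C * L)) * #|DD|%:R <= _).
    rewrite big_mkcond; apply: ler_sum => i _; case: ifP => [/andP[i1 i2]|_].
      by rewrite cD; exact: card_bad_samples.
    by rewrite !mulr_ge0// expR_ge0.
  rewrite sumr_const -[leLHS]mulr_natl card_prod cZ card_prod card_ord.
  by rewrite !natrM expr2.
rewrite ler_pdivlMr//; move: cardE sumE; lra.
Qed.

(** * Growth of the sample size *)

Lemma sample_size_itv s (C : R) N : 0 <= C -> (0 < N)%N ->
  4 * C * (s ^ 2 + 1)%:R * ln N%:R <= (sample_size s C N)%:R
    < 4 * C * (s ^ 2 + 1)%:R * ln N%:R + 1.
Proof.
move=> C0 N0; rewrite /sample_size; set y := _ * ln _.
have y0 : 0 <= y by rewrite !mulr_ge0// ln_ge0// ler1n.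
have c0 : (0 <= Num.ceil y)%R by rewrite -(ler_int R) (le_trans y0)// ceil_ge.
rewrite natr_absz ger0_norm//.
by have := ceil_itv y; rewrite intrB ltrBlDr andbC.
Qed.

(** With L = ln N, one has N = exp(L/4)^4 >= (1 + L/4)^4, a quartic in L that beats the square. This
    supplies 2 f^2 <= N for large [N]. *)
Lemma sqr_ln_le (c : R) : 0 <= c ->
  \forall N \near \oo, 2 * (c * ln N%:R + 1) ^+ 2 <= N%:R.
Proof.
move=> c0; pose c' := 4 * c + 1.
(* From L >= 8 c' it follows that y = 1 + L/4 >= 2 c', hence 2 (c' y)^2 <= y^4. *)
exists (Num.truncn (expR (8 * c'))).+1 => // N /= hN.
have eN : expR (8 * c') <= N%:R.
  by apply: le_trans (ltW (truncnS_gt _)) _; rewrite ler_nat.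
have N0 : 0 < N%:R :> R by apply: lt_le_trans eN; exact: expR_gt0.
set L := ln N%:R.
have hL : 8 * c' <= L by rewrite -ler_expR lnK// posrE.
have NE : N%:R = expR (L / 4) ^+ 4.
  by rewrite -expRM_natl mulrC divfK// lnK// posrE.
pose y := 1 + L / 4.
have y0 : 0 <= y by rewrite /y; move: hL; rewrite /c'; lra.
have yN : y ^+ 4 <= N%:R by rewrite NE lerXn2r// ?nnegrE ?expR_ge0// expR_ge1Dx.
apply: le_trans yN; apply: le_trans (_ : 2 * (c' * y) ^+ 2 <= _).
  rewrite ler_wpM2l// lerXn2r// ?nnegrE.
  - by move: hL; rewrite /c'; nra.
  - by rewrite mulr_ge0// /c'; lra.
  - by move: hL; rewrite /c' /y; lra.
rewrite exprMn mulrA (exprD y 2 2) ler_wpM2r ?sqr_ge0//.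
have : 2 * c' <= y by rewrite /y; move: hL; rewrite /c'; lra.
have : 0 <= c' by rewrite /c'; lra.
nra.
Qed.

End Sampling.

(** * The probability estimate for large [N] *)

Unset Implicit Arguments.

Theorem mainTheorem4 (R : realType) (s : nat) (C delta : R)
    (hs : (1 <= s)%N) (hC : 1 < C) (hdelta : delta < C - 1) :
  exists A : R, \forall N \near \oo,
    1 - A * (N%:R `^ (- delta)) <=
    unif_prob R
      [set Omega : {set 'Z_N} | #|Omega| == sample_size s C N]%SET
      (fun Omega => forall x : {ffun 'Z_N -> R[i]},
         (l0norm x <= s)%N -> unique_min_extension Omega x).
Proof.
(* The number of directions times the factor 2 lost to sampling without replacement. *)
exists (2 * (2 * mesh s).+1%:R ^+ 2).
have C0 : 0 <= C by lra.
have c0 : 0 <= 4 * C * (s ^ 2 + 1)%:R by rewrite !mulr_ge0.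
near=> N.
have N1 : (1 < N)%N by near: N; exact: nbhs_infty_gt.
have N0 : 0 < N%:R :> R by rewrite ltr0n ltnW.
have L0 : 0 < ln N%:R :> R by rewrite ln_gt0// ltr1n.
have /andP[f1 f2] := sample_size_itv s C0 (ltnW N1).
set f := sample_size s C N in f1 f2 *.
have f0 : (0 < f)%N.
  rewrite -(ltr0n R); apply: lt_le_trans f1.
  by rewrite !mulr_gt0// ?ltr0n ?addn1//; lra.
have fN : (2 * f ^ 2 <= N)%N.
  rewrite -(ler_nat R) natrM natrX.
  apply: le_trans (_ : 2 * (4 * C * (s ^ 2 + 1)%:R * ln N%:R + 1) ^+ 2 <= _).
    rewrite ler_wpM2l// lerXn2r ?nnegrE ?(ltW f2)//.
    by rewrite addr_ge0// mulr_ge0// ltW.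
  by near: N; exact: sqr_ln_le.
apply: le_trans (failure_probability N1 hs f0 fN _ f1); last first.
  by rewrite mulr_ge0// ltW.
rewrite lerD2l lerN2 ler_wpM2l//.
(* All powers of [N] become exponentials of multiples of ln N > 0; what remains is 1 - C <= -
   delta. *)
rewrite /powR gt_eqF// -{1}(lnK (x := N%:R)) ?posrE// -expRD ler_expR.
nra.
Unshelve. all: end_near. Qed.
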